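(* Let $q_1=6t+1$ be a prime power with $t\ge 1$, let $n\ge 1$ and $q=q_1^n$. Let $\alpha$ be a primitive $6$th root of unity in $\mathbb{F}_{q_1}\subseteq\mathbb{F}_q$. Let $S\subseteq\mathbb{F}_q$ be a subset such that no three distinct elements of $S$ are collinear (viewing $\mathbb{F}_q$ as the vector space $\mathbb{F}_{q_1}^n$). Then the code $$\mathcal{C}=\{(g,\; s+g,\; \alpha s+g)^T : s\in S,\ g\in\mathbb{F}_q\}\subseteq\mathbb{F}_q^3$$ is a $\overline{3}$-SC$(3,q|S|,q)$.
   Context: An $(n,M,q)$ code is a set $\mathcal{C}\subseteq Q^n$ of $M$ distinct codewords, $|Q|=q$. For $\mathcal{C}_0\subseteq\mathcal{C}$, let $\mathcal{C}_0(i)=\{\mathbf{c}(i):\mathbf{c}\in\mathcal{C}_0\}$ and $\mathsf{desc}(\mathcal{C}_0)=\mathcal{C}_0(1)\times\cdots\times\mathcal{C}_0(n)$. $\mathcal{C}$ is a $\overline{t}$-separable code ($\overline{t}$-SC$(n,M,q)$) if for any distinct $\mathcal{C}_1,\mathcal{C}_2\subseteq\mathcal{C}$ with $1\le|\mathcal{C}_1|,|\mathcal{C}_2|\le t$, $\mathsf{desc}(\mathcal{C}_1)\ne\mathsf{desc}(\mathcal{C}_2)$. Three points of $\mathbb{F}_{q_1}^n$ are collinear if they lie on a common affine line $\{a+\lambda b:\lambda\in\mathbb{F}_{q_1}\}$, $b\neq 0$. (In the paper, $\mathcal{C}$ is described as the code generated by the submatrix $D|_S$ of the difference matrix $D$ with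 columns $(0,s,\alpha s)^T$, $s\in\mathbb{F}_q$, i.e. the set of all translates of these columns by constants $g\in\mathbb{F}_q$.) *)

(* Defs.v *)
From HB Require Import structures.
From mathcomp Require Import all_boot all_order all_algebra all_field.

Set Implicit Arguments.
Unset Strict Implicit.
Unset Printing Implicit Defensive.

Import GRing.Theory.
Local Open Scope ring_scope.

Section Codes.
Context {Q : finType} {n : nat}.
Implicit Types C : {set n.-tuple Q}.

Definition coord_set C (i : 'I_n) : {set Q} := [set tnth c i | c in C].

Definition desc C : {set n.-tuple Q} :=
  [set x | [forall i : 'I_n, tnth x i \in coord_set C i]].

(* C is an (n, M, q) code; the length n is read off the type of C. *)
Definition is_code (M q : nat) C : Prop := #|Q| = q /\ #|C| = M.

Definition bar_separable (t : nat) C : Prop :=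
  forall C1 C2 : {set n.-tuple Q},
    C1 \subset C -> C2 \subset C ->
    (1 <= #|C1| <= t)%N -> (1 <= #|C2| <= t)%N ->
    C1 <> C2 -> desc C1 <> desc C2.

Definition bar_separable_code (t M q : nat) C : Prop :=
  is_code M q C /\ bar_separable t C.

End Codes.

Section Lines.
Context {K : fieldType} {V : lmodType K}.

Definition on_line (a b x : V) : Prop := exists l : K, x = a + l *: b.

Definition collinear (x y z : V) : Prop :=
  exists a b : V, [/\ b != 0, on_line a b x, on_line a b y & on_line a b z].

End Lines.

(* All translates, by constants g, of the columns (0, s, a s)^T with s in S. *)
Definition translate_code (F : finFieldType) (a : F) (S : {set F}) :
    {set 3.-tuple F} :=
  [set [tuple g; s + g; a * s + g] | s in S, g in [set: F]].

(* Main.v *)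
(** A codeword is a triple [(x, y, z)] with [y - x] in [S] and
    [z = x + a (y - x)], an "equilateral triangle"; two coordinates determine
    it.  Let [C1 <> C2] have at most three words each and the same descendants.
    A word of [C1] outside [C2] agrees with the words of [C2] at three different
    positions, one each, so [#|C2| = 3]; and symmetrically.  If [C1] and [C2]
    share a word [u], then words [c] of [C1 \ C2] and [d] of [C2 \ C1] and [u]
    agree pairwise at the three different positions.  If they share none, the
    agreement positions form a Latin square of order 3.  In both cases the linear
    relations between the coordinates yield [x <> y] in [S] with
    [x + a (y - x)] in [S], and these three points are collinear. *)
Require Import Defs.
From HB Require Import structures.
From mathcomp Require Import all_boot all_order all_algebra all_field.
From mathcomp Require Import ring.

Import GRing.Theory.
Local Open Scope ring_scope.

(** * Primitive sixth roots of unity *)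

Lemma prim6_root_neq (F : fieldType) (a : F) :
  6.-primitive_root a -> [/\ a != 0, a != 1 & a + 1 != 0].
Proof.
move=> a6; have n2 : a ^+ 2 - 1 != 0 by rewrite subr_eq0 -(prim_order_dvd a6).
split; first by apply: contra_eqN (prim_expr_order a6) => /eqP->;
  rewrite expr0n eq_sym oner_eq0.
  by apply: contraNneq n2 => ->; rewrite expr1n subrr.
apply: contraNneq n2 => h; have -> : a ^+ 2 - 1 = (a + 1) * (a - 1) by ring.
by rewrite h mul0r.
Qed.

(** [a ^+ 6 - 1] factors as [(a ^+ 3 - 1) * (a + 1) * (a ^+ 2 - a + 1)], and the order of [a] rules
    out the first two factors. *)
Lemma prim6_root_eq (F : fieldType) (a : F) :
  6.-primitive_root a -> a ^+ 2 = a - 1.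
Proof.
move=> a6; have [_ _ n1] := prim6_root_neq F a a6.
have n3 : a ^+ 3 - 1 != 0 by rewrite subr_eq0 -(prim_order_dvd a6).
apply/eqP; rewrite -subr_eq0.
have: (a ^+ 3 - 1) * ((a + 1) * (a ^+ 2 - (a - 1))) = 0.
  by transitivity (a ^+ 6 - 1); [ring | rewrite (prim_expr_order a6) subrr].
by move/eqP; rewrite !mulf_eq0 (negPf n3) (negPf n1).
Qed.

(** * Codes in which distinct words agree at most once *)

Section Descendants.
Context {Q : finType} {n : nat}.
Implicit Types (C D : {set n.-tuple Q}) (c d : n.-tuple Q).

Definition determined_by_pairs C : Prop :=
  forall c d i j, c \in C -> d \in C -> i != j ->
    tnth c i = tnth d i -> tnth c j = tnth d j -> c = d.

Lemma sub_desc C : C \subset desc C.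
Proof.
apply/subsetP => c cC; rewrite inE; apply/forallP => i.
by apply/imsetP; exists c.
Qed.

Lemma desc_witness D c : c \in desc D ->
  exists f : 'I_n -> n.-tuple Q, forall i, f i \in D /\ tnth c i = tnth (f i) i.
Proof.
rewrite inE => /forallP cD.
have /fin_all_exists[f fP] : forall i, exists d, d \in D /\ tnth c i = tnth d i.
  by move=> i; have /imsetP[d dD ->] := cD i; exists d.
by exists f.
Qed.

(** Choose for each position [i] a word [f i] of [D] agreeing with [c] there. A word chosen twice
    would agree with [c] at two positions and so equal [c]; hence [f] is injective, and since [D]
    has at most [n] words it is a bijection onto [D]. *)
Lemma desc_agreement C D c : determined_by_pairs C ->
  D \subset C -> c \in C -> c \notin D -> (#|D| <= n)%N -> c \in desc D ->
  [/\ #|D| = n,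
      forall d, d \in D -> exists i, tnth c i = tnth d i
    & forall d d' i, d \in D -> d' \in D ->
        tnth c i = tnth d i -> tnth c i = tnth d' i -> d = d'].
Proof.
move=> Cdet /subsetP DC cC cD leD /desc_witness[f fP].
have f_inj : injective f.
  move=> i j fij; apply/eqP/negP => /negP ij; case/negP: cD.
  have [fiD fi] := fP i; have [_ fj] := fP j.
  by rewrite (Cdet c (f i) i j) // ?DC // fij.
have Dim : f @: [set: 'I_n] = D.
  apply/eqP; rewrite eqEcard card_imset // cardsT card_ord leD andbT.
  by apply/subsetP => _ /imsetP[i _ ->]; have [] := fP i.
have fD d : d \in D -> exists i, d = f i.
  by rewrite -Dim => /imsetP[i _ ->]; exists i.
have fE d i : d \in D -> tnth c i = tnth d i -> d = f i.
  move=> dD cd; have [j dj] := fD d dD; have [<-|ij] := eqVneq j i; first by [].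
  case/negP: cD; rewrite (Cdet c d j i) // ?DC //.
  by rewrite dj; have [] := fP j.
split.
- by rewrite -Dim card_imset // cardsT card_ord.
- by move=> d /fD[i ->]; exists i; have [] := fP i.
- by move=> d d' i dD d'D /(fE _ _ dD)-> /(fE _ _ d'D)->.
Qed.

End Descendants.

Lemma ord3P (i : 'I_3) : [\/ i = 0, i = 1 | i = 2%:R].
Proof.
by case: i => [[|[|[|//]]] hi]; [constructor 1|constructor 2|constructor 3];
  apply/val_inj.
Qed.

(** * Linear relations in the translate code *)

Section TranslateCode.
Context {F : finFieldType} (a : F) (S : {set F}).
Hypothesis a6 : 6.-primitive_root a.

(** The translate by [g] of the column of [s] has entry [g + weight i * s] at [i], so the three
    positions can be treated uniformly. *)
Definition weight (i : 'I_3) : F := tnth [tuple 0; 1; a] i.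

Let aa : a ^+ 2 = a - 1 := prim6_root_eq F a a6.

Lemma weight_inj : injective weight.
Proof.
move=> i j; have [n0 n1 _] := prim6_root_neq F a a6; have n2 := oner_neq0 F.
by case: (ord3P i) => ->; case: (ord3P j) => -> //; rewrite /weight !(tnth_nth 0) /= => /eqP;
  rewrite ?(negPf n0) ?(negPf n1) ?(negPf n2) // eq_sym ?(negPf n0) ?(negPf n1) ?(negPf n2).
Qed.

(* The weights form an equilateral triangle, up to orientation. *)
Lemma weight_triangle i j k : i != j -> i != k -> j != k ->
  weight j - weight i = a * (weight j - weight k) \/
  weight i - weight k = a * (weight j - weight k).
Proof.
by case: (ord3P i) => ->; case: (ord3P j) => ->; case: (ord3P k) => -> //;
  rewrite /weight !(tnth_nth 0) /= => _ _ _;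
  (left; ring: aa) || (right; ring: aa).
Qed.

Definition slope (w : 3.-tuple F) : F := tnth w 1 - tnth w 0.

Lemma translate_codeP w : w \in translate_code a S ->
  slope w \in S /\ forall i, tnth w i = tnth w 0 + weight i * slope w.
Proof.
case/imset2P => s g sS _ ->; rewrite /slope !(tnth_nth 0) /= addrK; split=> // i.
by case: (ord3P i) => ->; rewrite /weight !(tnth_nth 0) /=; ring.
Qed.

Lemma translate_code_slope_inj c d i :
  c \in translate_code a S -> d \in translate_code a S ->
  slope c = slope d -> tnth c i = tnth d i -> c = d.
Proof.
move=> /translate_codeP[_ cE] /translate_codeP[_ dE] cd.
rewrite cE dE cd => /addIr cd0; apply: eq_from_tnth => k.
by rewrite cE dE cd cd0.
Qed.

Lemma translate_code_det : determined_by_pairs (translate_code a S).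
Proof.
move=> c d i j cC dC ij cdi cdj; apply: (translate_code_slope_inj c d i) => //.
have [[_ cE] [_ dE]] := (translate_codeP c cC, translate_codeP d dC).
apply/eqP; rewrite -subr_eq0.
have: (weight i - weight j) * (slope c - slope d) = 0.
  transitivity ((tnth c i - tnth d i) - (tnth c j - tnth d j)).
    by rewrite !(cE i, cE j, dE i, dE j); ring.
  by rewrite cdi cdj !subrr.
by move/eqP; rewrite mulf_eq0 !subr_eq0 (inj_eq weight_inj) (negPf ij).
Qed.

Lemma card_translate_code : #|translate_code a S| = (#|F| * #|S|)%N.
Proof.
rewrite /translate_code curry_imset2X card_in_imset.
  by rewrite cardsX cardsT mulnC.
by move=> [s g] [r h] _ _ /= /(congr1 val) /= [-> /addIr->].
Qed.

Hypothesis S_triangle_free : forall x y, x \in S -> y \in S -> x != y ->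
  x + a * (y - x) \notin S.

(** Eliminating the translation constants from the three agreements makes [slope u] an affine
    combination of [slope c] and [slope d]. By [weight_triangle] one of its coefficients is [a], so
    the slopes form a forbidden triangle. *)
Lemma no_triangle_of_words c d u i j k :
  c \in translate_code a S -> d \in translate_code a S ->
  u \in translate_code a S -> c != d -> i != j -> i != k -> j != k ->
  tnth c i = tnth d i -> tnth c j = tnth u j -> tnth d k = tnth u k -> False.
Proof.
move=> cC dC uC cd ij ik jk hi hj hk.
have [scS cE] := translate_codeP c cC; have [sdS dE] := translate_codeP d dC.
have [suS uE] := translate_codeP u uC.
have scd : slope c != slope d.
  by apply: contraNneq cd => scd; rewrite (translate_code_slope_inj c d i).
have suE : (weight j - weight k) * slope u =
    (weight j - weight i) * slope c + (weight i - weight k) * slope d.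
  apply/eqP; rewrite -subr_eq0; apply/eqP.
  transitivity ((tnth c i - tnth d i) - (tnth c j - tnth u j)
    + (tnth d k - tnth u k)); last by rewrite hi hj hk !(subrr, addr0).
  by rewrite !(cE i, cE j, dE i, dE k, uE j, uE k); ring.
have njk : weight j - weight k != 0 by rewrite subr_eq0 (inj_eq weight_inj).
have [ji|ik'] := weight_triangle i j k ij ik jk.
- have su_d : slope u = slope d + a * (slope c - slope d).
    apply: (mulfI njk); rewrite suE.
    have -> : weight i = weight j - (weight j - weight i) by ring.
    by rewrite ji; ring.
  by have := S_triangle_free _ _ sdS scS; rewrite eq_sym scd -su_d suS => /(_ isT).
- have su_c : slope u = slope c + a * (slope d - slope c).
    apply: (mulfI njk); rewrite suE.
    have -> : weight i = weight k + (weight i - weight k) by ring.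
    by rewrite ik'; ring.
  by have := S_triangle_free _ _ scS sdS; rewrite scd -su_c suS => /(_ isT).
Qed.

(** Addition in ['I_3] is modulo 3: the Latin square is the Cayley table of the cyclic group of
    order 3. *)
Definition latin_agreement (c d : 'I_3 -> 3.-tuple F) : Prop :=
  forall i j, tnth (c i) (i + j) = tnth (d j) (i + j).

Lemma latin_slopes c d : (forall i, c i \in translate_code a S) ->
  (forall i, d i \in translate_code a S) -> latin_agreement c d ->
  slope (c 1) = slope (c 0) + a * (slope (c 2%:R) - slope (c 0)).
Proof.
move=> cC dC cd.
have cE i := (translate_codeP _ (cC i)).2; have dE i := (translate_codeP _ (dC i)).2.
have w0 : weight 0 = 0 by [].
have w1 : weight 1 = 1 by [].
have w2 : weight 2%:R = a by [].
have E i j k : i + j == k -> tnth (c i) 0 + weight k * slope (c i) =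
    tnth (d j) 0 + weight k * slope (d j) by move=> /eqP<-; rewrite -cE -dE.
move: (E 0 0 0 isT) (E 0 1 1 isT) (E 0 2%:R 2%:R isT) (E 1 0 1 isT)
  (E 1 1 2%:R isT) (E 1 2%:R 0 isT) (E 2%:R 0 2%:R isT) (E 2%:R 1 0 isT)
  (E 2%:R 2%:R 1 isT).
rewrite w0 w1 w2 !mul0r !mul1r !addr0.
move: (slope (c 0)) (slope (c 1)) (slope (c 2%:R)) (slope (d 0)) (slope (d 1))
  (slope (d 2%:R)) => s0 s1 s2 r0 r1 r2.
move: (tnth (c 0) 0) (tnth (c 1) 0) (tnth (c 2%:R) 0) (tnth (d 0) 0)
  (tnth (d 1) 0) (tnth (d 2%:R) 0) => g0 g1 g2 h0 h1 h2.
move=> e00 e01 e02 e10 e11 e12 e20 e21 e22.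
(* Positions 0 and 1 express each [d j] through the words of [c]; position 2 then yields relations
   among the words of [c] alone. *)
have r0E : r0 = g1 + s1 - g0 by rewrite e00 e10; ring.
have r1E : r1 = g0 + s0 - g2 by rewrite e21 e01; ring.
have r2E : r2 = g2 + s2 - g1 by rewrite e12 e22; ring.
have f : g2 + a * s2 - (g0 + a * (g1 + s1 - g0)) = 0.
  by rewrite e20 -r0E -e00 subrr.
have f' : g0 + a * s0 - (g1 + a * (g2 + s2 - g1)) = 0.
  by rewrite e02 -r2E -e12 subrr.
apply/eqP; rewrite -subr_eq0; apply/eqP.
(* Since [a ^+ 3 = -1], the multiplier [a ^+ 2] makes all [g] terms cancel; [1 - a] is the inverse
   of [a] and normalizes the coefficient of [s1]. *)
transitivity ((1 - a) * (- (g2 + a * s2 - (g0 + a * (g1 + s1 - g0)))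
  + a ^+ 2 * (g0 + a * s0 - (g1 + a * (g2 + s2 - g1))))).
  by ring: aa.
by rewrite f f' oppr0 !mulr0 addr0 mulr0.
Qed.

(** The triangle of slopes from [latin_slopes] lies in [S], so it must degenerate to a point. *)
Lemma latin_slopes_eq c d : (forall i, c i \in translate_code a S) ->
  (forall i, d i \in translate_code a S) -> latin_agreement c d ->
  slope (c 0) = slope (c 2%:R) /\ slope (c 0) = slope (c 1).
Proof.
move=> cC dC cd; have s1E := latin_slopes c d cC dC cd.
have sS i := (translate_codeP _ (cC i)).1.
have s02 : slope (c 0) = slope (c 2%:R).
  apply/eqP/negPn/negP => s02.
  by have := S_triangle_free _ _ (sS 0) (sS 2%:R) s02; rewrite -s1E sS.
by rewrite s1E -s02 subrr mulr0 addr0.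
Qed.

(** The agreement is symmetric, so [c] and [d] each have a constant slope. Four agreements then show
    that [a + 1] kills the difference of these slopes; equal slopes and agreement at 0 give equal
    words. *)
Lemma latin_agreement_meet c d : (forall i, c i \in translate_code a S) ->
  (forall i, d i \in translate_code a S) -> latin_agreement c d -> c 0 = d 0.
Proof.
move=> cC dC cd.
have dc : latin_agreement d c by move=> i j; rewrite addrC cd.
have [sc2 sc1] := latin_slopes_eq c d cC dC cd.
have [sd2 sd1] := latin_slopes_eq d c dC cC dc.
have cE i := (translate_codeP _ (cC i)).2; have dE i := (translate_codeP _ (dC i)).2.
have w0 : weight 0 = 0 by [].
have w1 : weight 1 = 1 by [].
have w2 : weight 2%:R = a by [].
have E i j k : i + j == k -> tnth (c i) 0 + weight k * slope (c i) =
    tnth (d j) 0 + weight k * slope (d j) by move=> /eqP<-; rewrite -cE -dE.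
move: (E 0 0 0 isT) (E 1 0 1 isT)
  (E 0 2%:R 2%:R isT) (E 1 2%:R 0 isT).
rewrite w0 w1 w2 -sc1 -sd2 !mul0r !mul1r !addr0 => e00 e10 e02 e12.
apply: (translate_code_slope_inj _ _ 0) => //.
have [_ _ n1] := prim6_root_neq F a a6; apply: (mulfI n1).
apply/eqP; rewrite -subr_eq0; apply/eqP.
transitivity ((tnth (c 0) 0 + a * slope (c 0) - (tnth (d 2%:R) 0 + a * slope (d 0)))
  - (tnth (c 0) 0 - tnth (d 0) 0) - (tnth (c 1) 0 - tnth (d 2%:R) 0)
  + (tnth (c 1) 0 + slope (c 0) - (tnth (d 0) 0 + slope (d 0)))); first by ring.
by rewrite e02 e10 e12 e00 !(subrr, addr0).
Qed.

Lemma translate_code_bar_separable : bar_separable 3 (translate_code a S).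
Proof.
set C := translate_code a S; have Cdet : determined_by_pairs C := translate_code_det.
move=> C1 C2 sC1 sC2 /andP[_ le1] /andP[_ le2] neq12 eq_desc; apply: neq12.
have [inC1 inC2] := (subsetP sC1, subsetP sC2).
have C1_12 c : c \in C1 -> c \in desc C2.
  by rewrite -eq_desc; apply/subsetP/sub_desc.
have C2_21 d : d \in C2 -> d \in desc C1.
  by rewrite eq_desc; apply/subsetP/sub_desc.
have agr1 c (cC : c \in C1) cC2 :=
  desc_agreement C C2 c Cdet sC2 (inC1 c cC) cC2 le2 (C1_12 c cC).
have agr2 d (dC : d \in C2) dC1 :=
  desc_agreement C C1 d Cdet sC1 (inC2 d dC) dC1 le1 (C2_21 d dC).
have [sub12 | /subsetPn[c cC1 cC2]] := boolP (C1 \subset C2).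
  apply/eqP; rewrite eqEcard sub12 /= leqNgt; apply/negP => lt12.
  have /subsetPn[d dC2 dC1] : ~~ (C2 \subset C1).
    by apply: contraL lt12 => /subset_leq_card; rewrite -leqNgt.
  by have [c1 _ _] := agr2 d dC2 dC1; move: lt12; rewrite c1 ltnNge le2.
have [c2 agr_c uniq_c] := agr1 c cC1 cC2.
have [sub21 | /subsetPn[d dC2 dC1]] := boolP (C2 \subset C1).
  by apply/esym/eqP; rewrite eqEcard sub21 c2.
have [_ agr_d uniq_d] := agr2 d dC2 dC1.
have neq_cd : c != d by apply: contraNneq cC2 => ->.
have [/setP disj | [u]] := set_0Vmem (C1 :&: C2); last first.
  rewrite inE => /andP[uC1 uC2]; exfalso.
  have [[[i ci] [j cj]] [k dk]] := (agr_c d dC2, agr_c u uC2, agr_d u uC1).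
  have neq_du : d != u by apply: contraNneq dC1 => ->.
  have neq_cu : c != u by apply: contraNneq cC2 => ->.
  apply: (no_triangle_of_words c d u i j k (inC1 c cC1) (inC2 d dC2)
    (inC1 u uC1) neq_cd _ _ _ ci cj dk).
  - by apply: contraNneq neq_du => ij; rewrite (uniq_c d u i) // ij.
  - by apply: contraNneq neq_cu => ik; rewrite (uniq_d c u i) // ik.
  - by apply: contraNneq neq_du => jk; rewrite (uniq_c d u j) // cj jk dk.
have C1N x : x \in C1 -> x \notin C2.
  by move=> xC; apply/negP => xC2; have := disj x; rewrite !inE xC xC2.
have C2N x : x \in C2 -> x \notin C1.
  by move=> xC; apply/negP => xC1; have := disj x; rewrite !inE xC xC1.
have inj1 x y y' i : x \in C1 -> y \in C2 -> y' \in C2 ->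
    tnth x i = tnth y i -> tnth x i = tnth y' i -> y = y'.
  by move=> xC yC y'C; have [_ _] := agr1 x xC (C1N x xC); apply.
have inj2 y x x' i : y \in C2 -> x \in C1 -> x' \in C1 ->
    tnth y i = tnth x i -> tnth y i = tnth x' i -> x = x'.
  by move=> yC xC x'C; have [_ _] := agr2 y yC (C2N y yC); apply.
have uniq_pos x y i j : x \in C1 -> y \in C2 ->
    tnth x i = tnth y i -> tnth x j = tnth y j -> i = j.
  move=> xC yC xi xj; apply/eqP/negPn/negP => ij; case/negP: (C1N x xC).
  by rewrite (Cdet x y i j (inC1 x xC) (inC2 y yC) ij xi xj).
(* This labelling normalizes row and column 0 of the square: [y j] meets [c = x 0] at [j], and [x i]
   meets [y 0] at [i]. *)
have [y yP] := desc_witness C2 c (C1_12 c cC1).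
have [x xP] := desc_witness C1 (y 0) (C2_21 _ (yP 0).1).
have xC i : x i \in C1 := (xP i).1; have yC i : y i \in C2 := (yP i).1.
have x0 : x 0 = c by apply: (inj2 (y 0) _ _ 0) => //; [exact: (xP 0).2 | rewrite (yP 0).2].
have xy0 i : tnth (x i) i = tnth (y 0) i by rewrite (xP i).2.
have x0y i : tnth (x 0) i = tnth (y i) i by rewrite x0 (yP i).2.
have x_inj i j : x i = x j -> i = j.
  by move=> ij; apply: (uniq_pos (x i) (y 0)) => //; rewrite ij.
have y_inj i j : y i = y j -> i = j.
  by move=> ij; apply: (uniq_pos (x 0) (y i)) => //; rewrite ij.
(* Position [i] of [x i] is taken by [y 0], and position [j] of [y j] by [x 0]. *)
have agr i j : i != 0 -> j != 0 ->
    exists k, [/\ tnth (x i) k = tnth (y j) k, k != i & k != j].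
  move=> i0 j0; have [_ /(_ (y j) (yC j))[k xyk] _] := agr1 (x i) (xC i) (C1N _ (xC i)).
  exists k; split=> //.
  - apply: contraNneq j0 => ki; apply/eqP/y_inj.
    by apply: (inj1 (x i) _ _ i) => //; move: xyk; rewrite ki.
  - apply: contraNneq i0 => kj; apply/eqP/x_inj.
    by apply: (inj2 (y j) _ _ j) => //; move: xyk; rewrite kj => ->.
have offdiag i j : i != 0 -> j != 0 -> i != j -> tnth (x i) 0 = tnth (y j) 0.
  move=> i0 j0 ij; have [k [xyk ki kj]] := agr i j i0 j0.
  suff <- : k = 0 by [].
  by move: i0 j0 ij ki kj; case: (ord3P i) => ->; case: (ord3P j) => ->;
    case: (ord3P k) => ->.
(* Position 0 of [y i] is already taken by [x (- i)], which leaves only [i + i]. *)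
have diag i : i != 0 -> tnth (x i) (i + i) = tnth (y i) (i + i).
  move=> i0; have [k [xyk ki _]] := agr i i i0 i0.
  have iN : - i != i by move: i0; case: (ord3P i) => ->.
  have k0 : k != 0.
    apply: contraNneq iN => k0; apply/eqP/x_inj.
    apply: (inj2 (y i) _ _ 0) => //; last by move: xyk; rewrite k0.
    by apply/esym/offdiag => //; move: i0; case: (ord3P i) => ->.
  suff <- : k = i + i by [].
  by apply/eqP; move: i0 ki k0; case: (ord3P i) => ->; case: (ord3P k) => ->.
have lat : latin_agreement x y.
  move=> i j; have [-> | i0] := eqVneq i 0; first by rewrite add0r.
  have [-> | j0] := eqVneq j 0; first by rewrite addr0.
  have [<- | ij] := eqVneq i j; first exact: diag.
  suff -> : i + j = 0 by apply: offdiag.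
  by apply/eqP; move: i0 j0 ij; case: (ord3P i) => ->; case: (ord3P j) => ->.
case/negP: (C1N _ (xC 0)).
by rewrite (latin_agreement_meet x y) // => i; [apply: inC1 | apply: inC2].
Qed.

End TranslateCode.

(** Turns the absence of collinear triples into [S_triangle_free], with [k] the sixth root of
    unity. *)
Lemma collinear_affine (K : fieldType) (V : lmodType K) (k : K) (x y : V) :
  x != y -> collinear (K := K) x y (x + k *: (y - x)).
Proof.
move=> xy; exists x, (y - x); split; first by rewrite subr_eq0 eq_sym.
- by exists 0; rewrite scale0r addr0.
- by exists 1; rewrite scale1r addrC subrK.
- by exists k.
Qed.

(* finvect_type L is the type L itself, with its finite field structure;
   alpha%:A is the image of alpha under the inclusion of K in L. *)
Theorem theorem9 (t n q1 q : nat) (ht : (1 <= t)%N) (hn : (1 <= n)%N)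
    (hq1 : q1 = (6 * t + 1)%N) (hq : q = (q1 ^ n)%N)
    (K : finFieldType) (hK : #|K| = q1)
    (L : fieldExtType K) (hL : \dim {:L} = n)
    (alpha : K) (halpha : 6.-primitive_root alpha)
    (S : {set finvect_type L})
    (hS : forall x y z : finvect_type L,
        x \in S -> y \in S -> z \in S -> x <> y -> y <> z -> x <> z ->
        ~ collinear (K := K) x y z) :
  bar_separable_code 3 (q * #|S|)%N q
    (translate_code (alpha%:A : finvect_type L) S).
Proof.
have qE : #|finvect_type L| = q.
  rewrite hq -hK -hL.
  rewrite -(card_vspacef (Vector.class (finvect_type L))).
  exact: card_vspace.
have a6 : 6.-primitive_root (alpha%:A : finvect_type L).
  by rewrite (fmorph_primitive_root (in_alg L)).
split; first by split; rewrite ?card_translate_code ?qE.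
apply: translate_code_bar_separable => // x y xS yS xy; apply/negP => zS.
have [a0 a1 _] := prim6_root_neq _ _ a6.
have yx : y - x != 0 by rewrite subr_eq0 eq_sym.
(* The third point differs from [y] because [a] is not 1, and from [x] because [a] is not 0. *)
apply: (hS x y _ xS yS zS); first exact/eqP.
- move=> yz; case/eqP: a1; apply: (mulIf yx).
  by rewrite mul1r {2}yz addrAC subrr add0r.
- by move/eqP; rewrite -subr_eq0 opprD addNKr oppr_eq0 mulf_eq0 (negPf a0) (negPf yx).
- by rewrite mulr_algl; apply: collinear_affine.
Qed.
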